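(* Let $p$ be an odd prime, $n\ge 2$, and let $f:\mathbb{F}_{p^n}\to\mathbb{F}_p$ be a quadratic near-bent function. Fix a basis of $\mathbb{F}_{p^n}$ over $\mathbb{F}_p$ and write $f(\mathbf{x})=\mathbf{x}^TA\mathbf{x}$ with $A$ a symmetric $n\times n$ matrix over $\mathbb{F}_p$; let $C$ be a nonsingular matrix over $\mathbb{F}_p$ with $C^TAC=D$ diagonal. Then $D$ has exactly $n-1$ nonzero diagonal entries $d_1,\ldots,d_{n-1}$, and, setting $\Delta=\prod_{i=1}^{n-1}d_i$, there is a function $J:\mathrm{supp}(\widehat f)\to\mathbb{F}_p$ such that for every $b\in\mathbb{F}_{p^n}$ either $\widehat f(b)=0$ or $\widehat f(b)=\kappa\, p^{\frac{n+1}{2}}\epsilon_p^{J(b)}$, where $\kappa=\eta(\Delta)$ if $p\equiv1\pmod 4$; $\kappa=(-1)^{\frac{n-2}{2}}\eta(\Delta)\,i$ if $p\equiv 3\pmod 4$ and $n$ is even; $\kappa=(-1)^{\frac{n-1}{2}}\eta(\Delta)$ if $p\equiv3\pmod4$ and $n$ is odd.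
   Context: $\epsilon_p=e^{2\pi i/p}$, $\mathrm{Tr}_n$ the absolute trace, $\widehat{f}(b)=\sum_{x\in\mathbb{F}_{p^n}}\epsilon_p^{f(x)-\mathrm{Tr}_n(bx)}$, $\mathrm{supp}(\widehat f)=\{b:\widehat f(b)\ne 0\}$. Near-bent: $|\widehat{f}(b)|^2\in\{0,p^{n+1}\}$ for all $b$. Quadratic function: $f(x)=\mathrm{Tr}_n(\sum_{i=0}^la_ix^{p^i+1})$, $a_i\in\mathbb{F}_{p^n}$; identifying $x=\sum x_i\alpha_i$ with $\mathbf{x}=(x_1,\ldots,x_n)$ for the fixed basis $\{\alpha_i\}$, $f$ becomes a quadratic form over $\mathbb{F}_p$. $\eta$ denotes the quadratic character of $\mathbb{F}_p$. *)

(* Defs.v *)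
From HB Require Import structures.
From mathcomp Require Import all_boot all_order all_algebra all_field.
Set Implicit Arguments. Unset Strict Implicit. Unset Printing Implicit Defensive.
Import Order.TTheory GRing.Theory Num.Theory.
Local Open Scope ring_scope.

Definition emb (F : finFieldType) (p : nat) (k : 'F_p) : F := (nat_of_ord k)%:R.

Definition trF (F : finFieldType) (p n : nat) (x : F) : F :=
  \sum_(i < n) x ^+ (p ^ i).

Definition Tr (F : finFieldType) (p n : nat) (x : F) : 'F_p :=
  odflt 0 [pick k : 'F_p | emb F k == trF p n x].

(* epsilon_p = e^{2 pi i / p}: p.-root (-1) is e^{i pi/p} (minimal argument). *)
Definition epsp (p : nat) : algC := (p.-root (-1)) ^+ 2.

Definition epow (p : nat) (k : 'F_p) : algC := epsp p ^+ (nat_of_ord k).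

Definition quadf (F : finFieldType) (p n l : nat) (a : 'I_l.+1 -> F) (x : F) : 'F_p :=
  Tr p n (\sum_(i < l.+1) a i * x ^+ (p ^ i + 1)).

Definition walsh (F : finFieldType) (p n : nat) (f : F -> 'F_p) (b : F) : algC :=
  \sum_(x : F) epow (f x - Tr p n (b * x)).

Definition near_bent (F : finFieldType) (p n : nat) (f : F -> 'F_p) : Prop :=
  forall b : F, `|walsh n f b| ^+ 2 = 0 \/ `|walsh n f b| ^+ 2 = (p ^ n.+1)%:R.

Definition eta (p : nat) (x : 'F_p) : algC :=
  if x == 0 then 0 else if [exists y : 'F_p, y ^+ 2 == x] then 1 else -1.

Definition kappa (p n : nat) (Delta : 'F_p) : algC :=
  if (p %% 4 == 1)%N then eta Delta
  else if ~~ odd n then (-1) ^+ ((n - 2) %/ 2) * eta Delta * 'i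
  else (-1) ^+ ((n - 1) %/ 2) * eta Delta.

Definition coordmap (F : finFieldType) (p n : nat) (alpha : 'I_n -> F)
  (x : 'rV['F_p]_n) : F := \sum_(i < n) emb F (x 0 i) * alpha i.

(* Main.v *)
(* After diagonalising the form, the Walsh transform factors as a product of
   one-variable sums over 'F_p.  Completing the square, each nonzero diagonal
   entry d contributes eta(d) g times a power of epsilon_p, where g is the
   quadratic Gauss sum, and each zero entry contributes 0 or p.  Near-bentness at
   b = 0 gives the rank.  It remains to show that g is sqrt p or i sqrt p
   according to p mod 4.  With m = (p-1)/2, one compares g with
   h = prod_(i < m) (eps^(2i+1) - eps^-(2i+1)): both have square (-1)^m p, so
   g = +-h; the sign is + because the polynomials representing g and h have the
   same first nonzero coefficient at X = 1 modulo p.  Finally h is a product of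
   factors 2i sin(2 pi (2i+1) / p), whose signs can be read off. *)
Require Import Defs.
From HB Require Import structures.
From mathcomp Require Import all_boot all_order all_algebra all_field.
From mathcomp Require Import ring zify.
Import Order.TTheory GRing.Theory Num.Theory.
Local Open Scope ring_scope.
Set Implicit Arguments.
Unset Strict Implicit.
Unset Printing Implicit Defensive.

(** * The root of unity [p.-root (-1)] *)

(** On the upper unit half-circle a larger real part means a smaller argument, so the difference of
    arguments stays in [0, pi]. *)
Lemma Im_div_unit_ge0 (v z : algC) : `|v| = 1 -> `|z| = 1 ->
  0 <= 'Im v -> 0 <= 'Im z -> 'Re v <= 'Re z -> 0 <= 'Im (v / z).
Proof.
move=> v1 z1 b0 d0 ac; rewrite Im_div z1 expr1n divr1.
have Rr x : ('Re x : algC) \is Num.real := Creal_Re x.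
have E : ('Re v ^+ 2 + 'Im v ^+ 2 : algC) = 'Re z ^+ 2 + 'Im z ^+ 2.
  by rewrite -!normC2_Re_Im v1 z1.
rewrite subr_ge0.
case: (real_leP (real0 _) (Rr v)) => [a0 | /ltW a0].
  have c0 := le_trans a0 ac.
  rewrite ler_pM //.
  rewrite -ler_sqr ?nnegrE // -(lerD2l ('Re v ^+ 2)) E lerD2r.
  by rewrite ler_sqr ?nnegrE.
case: (real_leP (real0 _) (Rr z)) => [c0 | /ltW c0].
  by apply: le_trans (_ : 0 <= _); rewrite ?mulr_le0_ge0 ?mulr_ge0.
rewrite -lerN2 -!mulNr ler_pM ?oppr_ge0 ?lerN2 //.
rewrite -ler_sqr ?nnegrE // -(lerD2l ('Re z ^+ 2)) -E lerD2r.
by rewrite -sqrrN -[leRHS]sqrrN ler_sqr ?nnegrE ?oppr_ge0 ?lerN2.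
Qed.

Section RootOfMinusOne.

Variable p : nat.
Hypotheses (p_pr : prime p) (p_odd : odd p).

Let z : algC := p.-root (-1).
Let p_gt0 : (0 < p)%N := prime_gt0 p_pr.
Let p_gt1 : (1 < p)%N := prime_gt1 p_pr.

Lemma rootN1_exp : z ^+ p = -1.
Proof. exact: rootCK. Qed.

Lemma rootN1_norm : `|z| = 1.
Proof. by rewrite norm_rootC normrN1 rootC1. Qed.

Lemma rootN1_neq0 : z != 0.
Proof. by rewrite -normr_eq0 rootN1_norm oner_eq0. Qed.

(** The order divides [p]; order 1 would force [z = 1], against [z ^+ p = -1], or [z = -1], which is
    not a principal root. *)
Lemma epsp_prim : p.-primitive_root (epsp p).
Proof.
have ep : epsp p ^+ p = 1 by rewrite /epsp exprAC rootN1_exp sqrrN expr1n.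
have [m pm dm] := prim_order_exists p_gt0 ep.
have [m1|mp] : m = 1%N \/ m = p.
  by move/primeP: p_pr => [_ /(_ m dm)]/orP[]/eqP ->; [left|right].
exfalso; move: (prim_expr_order pm); rewrite m1 expr1 /epsp -/z => /eqP.
rewrite sqrf_eq1 => /orP[] /eqP z1.
  by move: rootN1_exp; rewrite z1 expr1n => /eqP; rewrite -addr_eq0 -mulr2n pnatr_eq0.
by move: (rootC_lt0 (-1 : algC) p_gt1); rewrite -/z z1 ltrN10.
by rewrite mp in pm.
Qed.

Lemma rootN1_odd_exp k : odd k -> z ^+ k ^+ p = -1.
Proof. by move=> ok; rewrite exprAC rootN1_exp -signr_odd ok expr1. Qed.

(* Among the roots of [X^p = -1] in the closed upper half-plane, [z] has the
   largest real part, i.e. the smallest argument: dividing by [z] stays there. *)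
Lemma Im_div_rootN1_ge0 (v : algC) : v ^+ p = -1 -> 0 <= 'Im v -> 0 <= 'Im (v / z).
Proof.
move=> vp v0; apply: Im_div_unit_ge0 => //; first 1 last.
- exact: rootN1_norm.
- exact: Im_rootC_ge0.
- exact: rootC_Re_max.
by apply: (pexpIrn p_gt0); rewrite ?nnegrE // -normrX vp normrN1 expr1n.
Qed.

Lemma Im_rootN1_exp_neq0 k : (0 < k < p)%N -> 'Im (z ^+ k) != 0.
Proof.
move=> /andP[k0 kp]; apply/eqP => /Creal_ImP zr.
have : (p %| k)%N.
  rewrite (prim_order_dvd epsp_prim) /epsp exprAC -/z -real_normK //.
  by rewrite normrX rootN1_norm !expr1n.
by move=> /(dvdn_leq k0); rewrite leqNgt kp.
Qed.

(** This fixes the argument of [z] as pi/p. The induction descends from [z ^+ p = -1]. *)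
Lemma Im_rootN1_exp_gt0 k : (0 < k < p)%N -> 0 < 'Im (z ^+ k).
Proof.
move=> kb; suff Hk : 0 <= 'Im (z ^+ k) by rewrite lt_neqAle eq_sym Im_rootN1_exp_neq0.
have ImN1 : 'Im (-1 : algC) = 0 by apply/Creal_ImP; rewrite rpredN rpred1.
case/andP: kb => _ /ltnW kp; rewrite -(subKn kp); move: (p - k)%N (leq_subr k p).
elim=> [|j IH] jp; first by rewrite subn0 rootN1_exp ImN1.
have {IH} := IH (ltnW jp); have -> : (p - j = (p - j.+1).+1)%N by lia.
move: (p - j.+1)%N (leq_subr j.+1 p) => i ip Hi.
have V m : `|z ^+ m| = 1 by rewrite normrX rootN1_norm expr1n.
have conjV m : (z ^+ m)^-1 = (z ^+ m)^* by rewrite invC_norm V expr1n invr1 mul1r.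
(* An odd power of [z] is again a root of X^p = -1, so it may be divided by [z]. For even [i.+1], if
   [z ^+ i] were below the real axis, its inverse could be divided by [z] instead, which would make
   [z ^+ i.+1] real. *)
have [oi|ei] := boolP (odd i.+1).
  move: (Im_div_rootN1_ge0 (rootN1_odd_exp oi) Hi).
  by rewrite exprSr mulfK // rootN1_neq0.
rewrite real_leNgt ?real0 ?Creal_Im //; apply/negP => Im0.
have oi : odd i by move: ei; rewrite /= negbK.
have: 0 <= 'Im ((z ^+ i)^-1 / z).
  apply: Im_div_rootN1_ge0; first by rewrite exprVn rootN1_odd_exp // invrN1.
  by rewrite conjV Im_conj oppr_ge0 ltW.
rewrite -invfM -exprSr conjV Im_conj oppr_ge0 => Hi'.
have [ilp|pli] := ltnP i.+1 p.
  have : 'Im (z ^+ i.+1) == 0 by rewrite eq_le Hi Hi'.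
  by apply/negP/Im_rootN1_exp_neq0; rewrite ilp.
have ipE : i.+1 = p \/ i = p by lia.
case: ipE => E; first by move: ei; rewrite E p_odd.
by move: Im0; rewrite E rootN1_exp ImN1 ltxx.
Qed.

End RootOfMinusOne.

(** * Additive and quadratic characters of ['F_p] *)

Section AdditiveCharacter.

Variable p : nat.
Hypothesis p_pr : prime p.

Let p_gt0 : (0 < p)%N := prime_gt0 p_pr.
Let prim := epsp_prim p_pr.

Lemma epow_nat (k : nat) : epow (k%:R : 'F_p) = epsp p ^+ k.
Proof. by rewrite /epow val_Fp_nat // prim_expr_mod. Qed.

Lemma epowD (x y : 'F_p) : epow (x + y) = epow x * epow y.
Proof. by rewrite -[x]natr_Zp -[y]natr_Zp -natrD !epow_nat exprD. Qed.

Lemma epow0 : epow (0 : 'F_p) = 1.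
Proof. exact: expr0. Qed.

Lemma epow_sum (I : finType) (P : pred I) (c : I -> 'F_p) :
  epow (\sum_(i | P i) c i) = \prod_(i | P i) epow (c i).
Proof. by apply: (big_morph (@epow p)); [exact: epowD | exact: epow0]. Qed.

Lemma epow_norm (x : 'F_p) : `|epow x| = 1.
Proof.
apply: (pexpIrn p_gt0); rewrite ?nnegrE // -normrX /epow exprAC.
by rewrite (prim_expr_order prim) !expr1n normr1.
Qed.

Lemma epow_conj (x : 'F_p) : (epow x)^* = epow (- x).
Proof.
have nz y : epow (y : 'F_p) != 0 by rewrite -normr_eq0 epow_norm oner_eq0.
apply: (mulfI (nz x)).
by rewrite -normCK epow_norm expr1n -epowD subrr epow0.
Qed.

Lemma sum_epow_lin (c : 'F_p) :
  \sum_x epow (c * x) = if c == 0 then p%:R else 0.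
Proof.
case: eqP => [->|/eqP c0].
  under eq_bigr do rewrite mul0r epow0.
  by rewrite sumr_const card_Fp.
rewrite (reindex_inj (mulfI (invr_neq0 c0))) /=.
under eq_bigr do rewrite mulVKf //.
have e1 : epow (1 : 'F_p) != 1.
  rewrite -[1]/(1%:R) epow_nat expr1; apply/eqP => e1.
  have := prim_order_dvd prim 1; rewrite expr1 e1 eqxx dvdn1 => /eqP p1.
  by move: p_pr; rewrite p1.
set s := \sum__ _; suff : (epow (1 : 'F_p) - 1) * s == 0.
  by rewrite mulf_eq0 subr_eq0 (negPf e1) => /eqP.
rewrite mulrBl mul1r mulr_sumr subr_eq0.
under eq_bigr do rewrite -epowD.
by rewrite /s [s in _ == s](reindex_inj (addrI (1 : 'F_p))).
Qed.

End AdditiveCharacter.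

Section QuadraticCharacter.

Variable p : nat.
Hypotheses (p_pr : prime p) (p_odd : odd p).

Lemma two_neq0_Fp : (2%:R : 'F_p) != 0.
Proof.
rewrite -(dvdn_pcharf (pchar_Fp p_pr)); apply/negP => /(@dvdn_leq p 2 isT).
by have := prime_gt1 p_pr; case: p p_odd => [|[|[|]]].
Qed.

Let nroots (y : 'F_p) := #|[set x : 'F_p | x ^+ 2 == y]|.

Let nroots_le2 y : (nroots y <= 2)%N.
Proof.
rewrite /nroots; have [->|[x0]] := set_0Vmem [set x : 'F_p | x ^+ 2 == y].
  by rewrite cards0.
rewrite inE => /eqP <-; apply: leq_trans (_ : #|[set x0; - x0]| <= 2)%N.
  by apply/subset_leq_card/subsetP => x; rewrite !inE eqf_sqr.
by rewrite cards2; case: (_ != _).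
Qed.

Let nroots_gt0 y : (0 < nroots y)%N = [exists x : 'F_p, x ^+ 2 == y].
Proof.
apply/card_gt0P/existsP => [[x]|[x xy]]; first by rewrite inE; exists x.
by exists x; rewrite inE.
Qed.

Let sum_nroots : (\sum_y nroots y = p)%N.
Proof.
transitivity (\sum_(x : 'F_p) 1)%N; last by rewrite sum1_card card_Fp.
rewrite [RHS](partition_big (fun x => x ^+ 2) xpredT) //=.
by apply: eq_bigr => y _; rewrite /nroots -sum1_card; apply: eq_bigl => x; rewrite inE.
Qed.

Lemma sum_sqr_nroots (f : 'F_p -> algC) :
  \sum_x f (x ^+ 2) = \sum_y f y *+ nroots y.
Proof.
rewrite (partition_big (fun x => x ^+ 2) xpredT) //=.
apply: eq_bigr => y _; rewrite /nroots -sumr_const.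
by apply: eq_big => [x|x /eqP ->]; rewrite ?inE.
Qed.

(* Both terms sum to [p] over all [y], and their sum never exceeds 2: a root of [y]
   and one of [y / d] would make [d] a square. *)
Let nroots_twist (d y : 'F_p) : d != 0 -> ~~ [exists x : 'F_p, x ^+ 2 == d] ->
  (nroots y + nroots (y / d)%R = 2)%N.
Proof.
move=> d0 dn.
have le2 w : (nroots w + nroots (w / d)%R <= 2)%N.
  have [->|w0] := eqVneq w 0%R.
    rewrite mul0r; suff N01 : (nroots 0%R <= 1)%N by exact: (leq_add N01 N01).
    by apply/card_le1_eqP => x x'; rewrite !inE !sqrf_eq0 => /eqP -> /eqP ->.
  have [] := leqP (nroots w) 0%N; have [] := leqP (nroots (w / d)%R) 0%N;
    have := nroots_le2 w; have := nroots_le2 (w / d)%R; try lia.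
  move=> _ _; rewrite !nroots_gt0 => /existsP[u /eqP uE] /existsP[v /eqP vE].
  case/negP: dn; apply/existsP; exists (v / u).
  by rewrite expr_div_n uE vE invf_div mulrCA divff // mulr1.
have sumd : (\sum_(w : 'F_p) nroots (w / d)%R = p)%N.
  by rewrite -[RHS]sum_nroots [RHS](reindex_inj (mulIf (invr_neq0 d0))).
have : (\sum_w (2 - (nroots w + nroots (w / d)%R)) = 0)%N.
  rewrite sumnB // big_split /= sum_nat_const card_Fp //.
  by rewrite sum_nroots sumd; lia.
move=> /eqP; rewrite sum_nat_eq0 => /forallP /(_ y) /=.
by rewrite subn_eq0 => h; apply/eqP; rewrite eqn_leq le2 h.
Qed.

Definition gauss : algC := \sum_(x : 'F_p) epow (x ^+ 2).

(** A square [d] is absorbed by rescaling [x]. For a nonsquare, the sums for [d] and for 1 add up to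
    twice a full additive character sum, which is 0. *)
Lemma gauss_twist (d : 'F_p) : d != 0 ->
  \sum_(x : 'F_p) epow (d * x ^+ 2) = Defs.eta d * gauss.
Proof.
move=> d0; rewrite /Defs.eta (negPf d0); case: ifPn => [/existsP[c /eqP cE]|dn].
  have c0 : c != 0 by rewrite -sqrf_eq0 cE.
  rewrite mul1r /gauss [RHS](reindex_inj (mulfI c0)); apply: eq_bigr => x _.
  by rewrite exprMn cE.
apply/eqP; rewrite mulN1r -addr_eq0 (sum_sqr_nroots (fun y => epow (d * y))).
rewrite /gauss (sum_sqr_nroots (@epow p)).
rewrite (reindex_inj (mulIf (invr_neq0 d0))) /= -big_split /=.
under eq_bigr => y _ do
  rewrite [y / d]mulrC mulVKf // -mulrnDr addnC [_^-1 * _]mulrC nroots_twist //.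
rewrite sumrMnl; have := sum_epow_lin p_pr 1; rewrite oner_eq0.
by under eq_bigr do rewrite mul1r; move=> ->; rewrite mul0rn.
Qed.

Lemma eta_sqr_neq0 (x : 'F_p) : x != 0 -> Defs.eta x ^+ 2 = 1.
Proof. by rewrite /Defs.eta => /negPf ->; case: ifP; rewrite ?sqrrN expr1n. Qed.

Lemma etaM (x y : 'F_p) : x != 0 -> y != 0 -> Defs.eta (x * y) = Defs.eta x * Defs.eta y.
Proof.
move=> x0 y0; rewrite /Defs.eta mulf_eq0 (negPf x0) (negPf y0) /=.
have [/existsP[u /eqP uE]|xn] := boolP [exists u, u ^+ 2 == x];
  have [/existsP[v /eqP vE]|yn] := boolP [exists v, v ^+ 2 == y].
- by rewrite mulr1 ifT //; apply/existsP; exists (u * v); rewrite exprMn uE vE.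
- rewrite mul1r ifN //; apply: contra yn => /existsP[w /eqP wE].
  by apply/existsP; exists (w / u); rewrite expr_div_n wE uE mulrC mulKf.
- rewrite mulr1 ifN //; apply: contra xn => /existsP[w /eqP wE].
  by apply/existsP; exists (w / v); rewrite expr_div_n wE vE mulfK.
(* Two nonsquares: [y] has no root, so by [nroots_twist] [y / x] has one, say [w], and
   [x * y = (w * x) ^+ 2]. *)
rewrite mulrNN mulr1 ifT //.
have : (0 < nroots (y / x)%R)%N.
  have := nroots_twist y x0 xn; have : nroots y = 0%N; last by lia.
  by apply/eqP; rewrite -leqn0 leqNgt nroots_gt0.
rewrite nroots_gt0 => /existsP[w /eqP wE]; apply/existsP; exists (w * x).
by rewrite exprMn wE expr2 mulrA divfK // mulrC.
Qed.

Lemma eta_prod (I : finType) (P : pred I) (d : I -> 'F_p) :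
  (forall i, P i -> d i != 0) -> Defs.eta (\prod_(i | P i) d i) = \prod_(i | P i) Defs.eta (d i).
Proof.
move=> d0; pose K (x : 'F_p) (y : algC) := x != 0 /\ Defs.eta x = y.
suff [] : K (\prod_(i | P i) d i) (\prod_(i | P i) Defs.eta (d i)) by [].
apply: (big_rec2 K) => [|i y x Pi [y0 <-]].
  split; rewrite ?oner_eq0 // /Defs.eta oner_eq0 ifT //.
  by apply/existsP; exists 1; rewrite expr1n.
by split; rewrite ?mulf_neq0 ?etaM ?d0.
Qed.

End QuadraticCharacter.

(** * Congruences modulo [p] *)

Section PolynomialCongruence.

Variable p : nat.
Hypothesis p_pr : prime p.

Let p_gt0 : (0 < p)%N := prime_gt0 p_pr.
Let p_gt1 : (1 < p)%N := prime_gt1 p_pr.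

Lemma Phi1 : 'Phi_1 = 'X - 1.
Proof. by have := prod_Cyclotomic (ltn0Sn 0); by rewrite big_seq1. Qed.

Lemma map_Phi_prime : map_poly (intr : int -> 'F_p) 'Phi_p = ('X - 1) ^+ p.-1.
Proof.
have X1_neq0 : 'X - 1 != 0 :> {poly 'F_p} by rewrite -size_poly_eq0 size_XsubC.
have pcharX : p \in [pchar {poly 'F_p}] by rewrite (rmorph_pchar polyC) ?pchar_Fp.
apply: (mulfI X1_neq0); rewrite -exprS prednK //.
have -> : ('X - 1) ^+ p = map_poly (intr : int -> 'F_p) ('X^p - 1).
  rewrite rmorphB rmorphXn rmorph1 /= map_polyX.
  by rewrite -!(pFrobenius_autE pcharX) rmorphB rmorph1.
have <- : \prod_(d <- [:: 1%N; p]) 'Phi_d = 'X^p - 1.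
  rewrite -(prod_Cyclotomic p_gt0); apply/esym/perm_big/uniq_perm => [||d].
  - exact: divisors_uniq.
  - by rewrite /= inE eq_sym neq_ltn p_gt1 orbT.
  rewrite -dvdn_divisors // !inE; apply/idP/orP; last by case=> /eqP ->.
  by move=> dp; apply/orP; case/primeP: p_pr => _ /(_ d dp).
by rewrite big_cons big_seq1 Phi1 rmorphM rmorphB rmorph1 /= map_polyX.
Qed.

(** Being the minimal polynomial of [epsp p], ['Phi_p] divides [q]. Modulo [p] it is (X - 1)^(p-1),
    so the shifted [q] is divisible by X^(p-1). *)
Lemma vanish_epsp_coef (q : {poly int}) k :
  (map_poly (intr : int -> algC) q).[epsp p] = 0 -> (k < p.-1)%N ->
  (map_poly (intr : int -> 'F_p) q \Po ('X + 1))`_k = 0.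
Proof.
move=> q0 kp.
have Phi_mon := Cyclotomic_monic p.
have qE := Pdiv.RingMonic.rdivp_eq Phi_mon q.
set r := Pdiv.Ring.rmodp _ _ in qE; set d := Pdiv.Ring.rdivp _ _ in qE.
have Phi0 : (map_poly (intr : int -> algC) 'Phi_p).[epsp p] = 0.
  rewrite (Cintr_Cyclotomic (epsp_prim p_pr)); apply/rootP.
  by rewrite root_cyclotomic epsp_prim.
have r0 : r = 0.
  have rz : root (map_poly (intr : int -> algC) r) (epsp p).
    by apply/rootP; move: q0; rewrite qE rmorphD rmorphM /= !hornerE Phi0 mulr0 add0r.
  have [f [fE _] fdvd] := minCpolyP (epsp p).
  have mE : map_poly (intr : int -> algC) r = map_poly ratr (map_poly (intr : int -> rat) r).
    by rewrite -map_poly_comp; apply: eq_map_poly => b; rewrite /= rmorph_int.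
  rewrite mE fdvd in rz.
  have rs : (size r < size 'Phi_p)%N by rewrite Pdiv.Ring.ltn_rmodpN0 ?monic_neq0.
  apply/eqP; apply: contraTT rs => rn0; rewrite -leqNgt.
  have <- : size f = size 'Phi_p.
    by rewrite -(size_map_poly (ratr : rat -> algC)) -fE
       (minCpoly_cyclotomic (epsp_prim p_pr)) size_cyclotomic size_Cyclotomic.
  have <- : size (map_poly (intr : int -> rat) r) = size r.
    by apply: size_map_inj_poly => //; exact: intr_inj.
  apply: dvdp_leq => //; rewrite -size_poly_eq0 size_map_inj_poly ?size_poly_eq0 //.
  exact: intr_inj.
rewrite qE r0 addr0 rmorphM /= map_Phi_prime comp_polyM rmorphXn /=.
rewrite rmorphB /= comp_polyX comp_polyC addrK.
by rewrite coefMXn kp.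
Qed.

Lemma coef_Xn_shift (R : nzRingType) n k : (('X^n : {poly R}) \Po ('X + 1))`_k = 'C(n, k)%:R.
Proof.
rewrite comp_Xn_poly exprD1n coef_sum.
under eq_bigr => i _ do rewrite coefMn coefXn.
case: (ltnP k n.+1) => [kn|nk]; last first.
  rewrite bin_small // big1 // => i _.
  by rewrite gtn_eqF ?mul0rn // (leq_trans (ltn_ord i)).
rewrite (bigD1 (Ordinal kn)) //= eqxx big1 ?addr0 // => i ik.
by rewrite -val_eqE /= eq_sym in ik; rewrite (negPf ik) mul0rn.
Qed.

Lemma natr_ffact (R : comNzRingType) n k :
  (n ^_ k)%:R = \prod_(i < k) (n%:R - i%:R) :> R.
Proof.
elim: k => [|k IH]; first by rewrite big_ord0.
rewrite ffactnSr natrM IH big_ord_recr /=; case: (leqP k n) => [kn|nk].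
  by rewrite natrB.
by rewrite -IH ffact_small // !mul0r.
Qed.

(** For j > 0, X^j - 1 has too few roots to kill all nonzero elements, and scaling by some [c] with
    c^j different from 1 multiplies the sum by c^j. *)
Lemma sum_expr_Fp j : (j < p.-1)%N -> \sum_(x : 'F_p) x ^+ j = 0.
Proof.
case: j => [_|j jp].
  by under eq_bigr do rewrite expr0; rewrite sumr_const card_Fp // pchar_Fp_0.
have [c c0 cj] : exists2 c : 'F_p, c != 0 & c ^+ j.+1 != 1.
  apply/exists_inP; rewrite -[X in is_true X]negbK negb_exists_in.
  apply/negP => /forall_inP c1.
  have : (size (enum [set~ 0%R : 'F_p]) <= j.+1)%N.
    apply: max_unity_roots => //; last exact: enum_uniq.
    apply/allP => x; rewrite mem_enum !inE => x0.
    by apply/unity_rootP/eqP; rewrite -[_ == _]negbK c1.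
  by rewrite -cardE cardsC1 card_Fp // leqNgt jp.
set s := \sum__ _; suff : (c ^+ j.+1 - 1) * s == 0.
  by rewrite mulf_eq0 subr_eq0 (negPf cj) => /eqP.
rewrite mulrBl mul1r mulr_sumr subr_eq0.
under eq_bigr do rewrite -exprMn.
by rewrite /s [s in _ == s](reindex_inj (mulfI c0)).
Qed.

Lemma exprp1_Fp (x : 'F_p) : x != 0 -> x ^+ p.-1 = 1.
Proof.
move=> x0; apply: (mulfI x0).
by rewrite -exprS prednK // mulr1; have := expf_card x; rewrite card_Fp.
Qed.

(** Powers below [p.-1] sum to 0; the leading term counts the nonzero elements, giving p - 1 =
    -1. *)
Lemma sum_horner_Fp (q : {poly 'F_p}) : q \is monic -> size q = p ->
  \sum_x q.[x] = -1.
Proof.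
move=> qm qs.
have qs' : (size q <= p.-1.+1)%N by rewrite qs prednK.
under eq_bigr do rewrite (horner_coef_wide _ qs').
rewrite exchange_big /= big_ord_recr /= big1 ?add0r => [|i _]; last first.
  by rewrite -mulr_sumr sum_expr_Fp // mulr0.
have -> : q`_p.-1 = 1 by move: (monicP qm); rewrite lead_coefE qs.
under eq_bigr do rewrite mul1r.
rewrite (bigD1 0%R) //= expr0n gtn_eqF ?add0r; last by rewrite -subn1 subn_gt0.
rewrite (eq_bigr (fun=> 1)) => [|x x0]; last exact: exprp1_Fp.
have := sumr_const (predC1 (0 : 'F_p)) (1 : 'F_p); rewrite cardC1 card_Fp // => ->.
by rewrite -subn1 natrB // pchar_Fp_0 // sub0r.
Qed.

End PolynomialCongruence.

(** * The quadratic Gauss sum *)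

(** Each shifted factor is X times a polynomial with constant term a_i - b_i, so [m] is the lowest
    degree that can occur. *)
Lemma coef_prod_Xn_shift (R : comNzRingType) m (a b : nat -> nat) :
  (\prod_(i < m) ('X^(a i) - 'X^(b i) : {poly R}) \Po ('X + 1))`_m =
  \prod_(i < m) ((a i)%:R - (b i)%:R).
Proof.
pose r i : {poly R} := \sum_(j < a i) ('X + 1) ^+ j - \sum_(j < b i) ('X + 1) ^+ j.
have geo n : ('X + 1) ^+ n = 'X * (\sum_(j < n) ('X + 1) ^+ j) + 1 :> {poly R}.
  by have := subrX1 ('X + 1 : {poly R}) n; rewrite addrK => <-; rewrite subrK.
have r0 i : (r i).[0] = (a i)%:R - (b i)%:R.
  have s n : (\sum_(j < n) ('X + 1) ^+ j).[0] = n%:R :> R.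
    rewrite horner_sum (eq_bigr (fun=> 1)) => [|j _]; last by rewrite !hornerE expr1n.
    by rewrite sumr_const card_ord.
  by rewrite /r hornerD hornerN !s.
have -> : \prod_(i < m) ('X^(a i) - 'X^(b i)) \Po ('X + 1) = (\prod_(i < m) r i) * 'X^m.
  rewrite rmorph_prod -[X in 'X^X](card_ord m) -prodr_const -big_split /=.
  apply: eq_bigr => i _; rewrite rmorphB /= !comp_Xn_poly (geo (a i)) (geo (b i)).
  by rewrite /r; ring.
rewrite coefMXn ltnn subnn -horner_coef0 horner_prod.
by apply: eq_bigr => i _.
Qed.

Lemma prod_odd_even (R : comPzSemiRingType) (F : nat -> R) m :
  \prod_(i < m.*2) F i.+1 = \prod_(i < m) (F i.*2.+1 * F i.*2.+2).
Proof.
elim: m => [|m IH]; first by rewrite !big_ord0.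
by rewrite doubleS !big_ord_recr /= IH mulrA.
Qed.

(* The even numbers below [2m+1] are the [2m+1-k] for [k] odd. *)
Lemma prod_odd_opp (R : comPzSemiRingType) (F : nat -> R) m :
  \prod_(i < m.*2) F i.+1 = \prod_(i < m) (F i.*2.+1 * F (m.*2.+1 - i.*2.+1)%N).
Proof.
rewrite prod_odd_even !big_split /=; congr (_ * _).
rewrite (reindex_inj rev_ord_inj) /=; apply: eq_bigr => i _; congr F.
by have := ltn_ord i; lia.
Qed.

Section GaussSum.

Variable p : nat.
Hypotheses (p_pr : prime p) (p_odd : odd p).

Let m := p./2.
Let p_gt1 : (1 < p)%N := prime_gt1 p_pr.
Let pE : p = m.*2.+1.
Proof. by rewrite -{1}(odd_double_half p) p_odd. Qed.
Let pred_pE : p.-1 = m.*2.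
Proof. by rewrite {1}pE. Qed.
Let m_gt0 : (0 < m)%N.
Proof. by have := p_gt1; rewrite pE; case: m. Qed.

(** The factors are 2i sin(2 pi k / p) for odd k. Writing p - k for -k keeps the exponents natural,
    so that the product lifts to a polynomial. *)
Definition odd_sine_prod : algC :=
  \prod_(i < p./2) (epsp p ^+ i.*2.+1 - epsp p ^+ (p - i.*2.+1)).

Lemma Wilson_Fp : (p.-1`!)%:R = -1 :> 'F_p.
Proof.
have : (p %| (p.-1)`!.+1)%N by rewrite -Wilson.
by rewrite (dvdn_pcharf (pchar_Fp p_pr)) -natr1 addr_eq0 => /eqP.
Qed.

Lemma fact_prod_Fp : (p.-1`!)%:R = \prod_(i < m.*2) (i.+1)%:R :> 'F_p.
Proof. by rewrite pred_pE fact_prod big_add1 big_mkord natr_prod. Qed.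

(** Multiplied by m!, each term is x^2 (x^2 - 1) ... (x^2 - m + 1), a monic polynomial in x of
    degree 2m = p - 1. *)
Lemma sum_bin_sqr_Fp :
  (\sum_(x : 'F_p) 'C(x ^+ 2, m)%:R) * (m`!)%:R = -1 :> 'F_p.
Proof.
pose q : {poly 'F_p} := \prod_(i < m) ('X^2 - (i%:R)%:P).
have q1 (i : 'I_m) : ('X^2 - (i%:R)%:P : {poly 'F_p}) \is monic by exact: monicXnsubC.
have qm : q \is monic by apply: monic_prod => i _; exact: q1.
have qs : size q = p.
  rewrite size_prod => [|i _]; last exact: monic_neq0.
  rewrite (eq_bigr (fun=> 3%N)) => [|i _]; last by rewrite size_XnsubC.
  by rewrite sum_nat_const card_ord [RHS]pE; lia.
rewrite -(sum_horner_Fp p_pr qm qs) mulr_suml; apply: eq_bigr => x _.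
rewrite -natrM bin_ffact natr_ffact horner_prod; apply: eq_bigr => i _.
by rewrite natr_Zp !hornerE.
Qed.

(** Modulo [p] each factor is twice an odd number; the 2s turn m! into the product of the even
    numbers below [p], and Wilson's theorem applies. *)
Lemma prod_odd_Fp :
  (\prod_(i < m) ((i.*2.+1)%:R - (p - i.*2.+1)%:R)) * (m`!)%:R = -1 :> 'F_p.
Proof.
rewrite -Wilson_Fp fact_prod_Fp (prod_odd_even (fun k => k%:R)).
rewrite fact_prod big_add1 big_mkord natr_prod -big_split /=.
apply: eq_bigr => i _; rewrite natrB ?pchar_Fp_0 //; last first.
  by have := ltn_ord i; have := pE; lia.
by rewrite -doubleS -[i.+1.*2]muln2 natrM; ring.
Qed.

(* Modulo [p], ['Phi_p] is [('X - 1)^(p-1)], so two integer combinations of powers of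
   [epsp p] that agree have the same expansion in powers of ['X - 1] up to degree
   [p-2]; the coefficients of degree [m = (p-1)/2] are compared here. *)
Lemma gauss_congr (e : int) :
  gauss p = e%:~R * odd_sine_prod -> e%:~R = 1 :> 'F_p.
Proof.
move=> Ge.
pose g (R : nzRingType) : {poly R} := \sum_(x : 'F_p) 'X^(x ^+ 2).
pose h (R : comNzRingType) : {poly R} := \prod_(i < m) ('X^(i.*2.+1) - 'X^(p - i.*2.+1)).
have mapq (R : comNzRingType) :
    map_poly (intr : int -> R) (g int - e%:P * h int) = g R - (e%:~R)%:P * h R.
  rewrite rmorphB rmorphM /= map_polyC /g /h rmorph_sum rmorph_prod; congr (_ - _ * _).
    by apply: eq_bigr => x _; rewrite /= map_polyXn.
  by apply: eq_bigr => x _; rewrite rmorphB /= !map_polyXn.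
have q0 : (map_poly (intr : int -> algC) (g int - e%:P * h int)).[epsp p] = 0.
  rewrite mapq !hornerE horner_prod horner_sum; apply/eqP; rewrite subr_eq0; apply/eqP.
  transitivity (gauss p); first by apply: eq_bigr => x _; rewrite hornerXn.
  by rewrite Ge; congr (_ * _); apply: eq_bigr => i _; rewrite !hornerE.
have mp : (m < p.-1)%N by rewrite pred_pE -addnn -[X in (X < _)%N]addn0 ltn_add2l.
have := vanish_epsp_coef p_pr q0 mp.
rewrite mapq comp_polyB comp_polyM comp_polyC coefB coefCM.
rewrite (coef_prod_Xn_shift _ m (fun i => i.*2.+1) (fun i => p - i.*2.+1)%N).
rewrite /g rmorph_sum coef_sum /=; under eq_bigr do rewrite coef_Xn_shift.
(* After multiplication by m! both coefficients are -1, which leaves -1 + e = 0. *)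
move/(congr1 ( *%R^~ (m`!)%:R)); rewrite mulrBl -mulrA sum_bin_sqr_Fp prod_odd_Fp mul0r.
by move/eqP; rewrite mulrN1 opprK addrC subr_eq0 => /eqP.
Qed.

(** With x = u + y one has x^2 - y^2 = u^2 + 2uy, and the sum over y vanishes unless u = 0. *)
Lemma norm_gauss : gauss p * (gauss p)^* = p%:R.
Proof.
transitivity (\sum_(u : 'F_p) epow (u ^+ 2) * \sum_(y : 'F_p) epow (u *+ 2 * y)).
  rewrite /gauss rmorph_sum mulr_suml.
  under eq_bigr do rewrite mulr_sumr.
  under [RHS]eq_bigr do rewrite mulr_sumr.
  rewrite exchange_big [RHS]exchange_big /=; apply: eq_bigr => y _.
  rewrite (reindex_inj (addIr y)) /=; apply: eq_bigr => u _.
  by rewrite epow_conj // -!epowD //; congr epow; ring.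
rewrite (bigD1 0%R) //= [X in _ + X]big1 => [|u u0]; rewrite sum_epow_lin //.
  by rewrite mul0rn eqxx expr0n epow0 mul1r addr0.
by rewrite -[u *+ 2]mulr_natr mulf_eq0 (negPf u0) (negPf (two_neq0_Fp p_pr p_odd)) mulr0.
Qed.

(** For odd [m] a root y of -1 would give y^(p-1) = -1. For even [m], pairing k with p - k in
    Wilson's theorem shows that the product of the odd numbers below [p] squares to -1. *)
Lemma etaN1 : Defs.eta (-1 : 'F_p) = (-1) ^+ m.
Proof.
rewrite /Defs.eta oppr_eq0 oner_eq0 -signr_odd.
have [om|em] := boolP (odd m).
  rewrite ifN //; apply/negP => /existsP[y /eqP yE].
  have y0 : y != 0 by rewrite -sqrf_eq0 yE oppr_eq0 oner_eq0.
  have := exprp1_Fp p_pr y0; rewrite pred_pE -mul2n exprM yE -signr_odd om expr1.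
  by move/eqP; rewrite eq_sym -addr_eq0 -mulr2n (negPf (two_neq0_Fp p_pr p_odd)).
rewrite ifT //; apply/existsP; exists (\prod_(i < m) (i.*2.+1)%:R).
rewrite -Wilson_Fp fact_prod_Fp (prod_odd_opp (fun k => k%:R)) expr2 -big_split /=.
apply/eqP.
rewrite [RHS](eq_bigr (fun i : 'I_m => - ((i.*2.+1)%:R * (i.*2.+1)%:R : 'F_p))) => [|i _].
  by rewrite prodrN card_ord -signr_odd (negPf em) expr0 mul1r.
by rewrite natrB -?pE ?pchar_Fp_0 ?sub0r ?mulrN //; have := ltn_ord i; have := pE; lia.
Qed.

(** Conjugation replaces x^2 by -x^2, hence multiplies the Gauss sum by eta(-1). *)
Lemma gauss_sqr : gauss p ^+ 2 = (-1) ^+ m * p%:R.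
Proof.
have := norm_gauss; have -> : (gauss p)^* = (-1) ^+ m * gauss p.
  rewrite -etaN1 -gauss_twist ?oppr_eq0 ?oner_eq0 // /gauss rmorph_sum.
  by apply: eq_bigr => x _; rewrite mulN1r -epow_conj.
by move=> <-; rewrite [gauss p * _]mulrCA signrMK expr2.
Qed.

Lemma prod_1_sub_prim_root (w : algC) :
  p.-primitive_root w -> \prod_(i < m.*2) (1 - w ^+ i.+1) = p%:R.
Proof.
have X1 : 'X - 1%:P != 0 :> {poly algC} by rewrite polyXsubC_eq0.
move=> wp; have := factor_Xn_sub_1 wp; rewrite subrX1 {1}pE.
rewrite big_mkord big_ord_recl expr0 => /(mulfI X1) E.
have := congr1 (horner^~ 1) E; rewrite horner_prod horner_sum => F.
transitivity (\sum_(i < p) (1 : algC)); last by rewrite sumr_const card_ord.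
transitivity (\sum_(i < p) ('X ^+ i : {poly algC}).[1]).
  by rewrite -F; apply: eq_bigr => i _; rewrite !hornerE.
by apply: eq_bigr => i _; rewrite hornerXn expr1n.
Qed.

Lemma epsp_conj k : (k <= p)%N -> (epsp p ^+ k)^* = epsp p ^+ (p - k).
Proof.
by move=> kp; rewrite -!epow_nat // epow_conj // natrB // pchar_Fp_0 // sub0r.
Qed.

Let odd_le_p (i : 'I_m) : (i.*2.+1 <= p)%N.
Proof. by have := ltn_ord i; have := pE; lia. Qed.

(** For x of modulus 1 with conjugate y, |x - y|^2 = (1 - x^2)(1 - y^2). These factors run over all
    nontrivial powers of [epsp p ^+ 2], again primitive because [p] is odd. *)
Lemma odd_sine_prod_norm : `|odd_sine_prod| = sqrtC p%:R.
Proof.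
suff E : `|odd_sine_prod| ^+ 2 = p%:R.
  by rewrite -E sqrCK // normr_ge0.
have wp : p.-primitive_root (epsp p ^+ 2).
  by rewrite prim_root_exp_coprime ?epsp_prim // coprime_sym coprimen2.
rewrite -(prod_1_sub_prim_root wp) (prod_odd_opp (fun k => 1 - epsp p ^+ 2 ^+ k)).
rewrite normr_prod -prodrXl; apply: eq_bigr => i _.
have exprC k : epsp p ^+ 2 ^+ k = (epsp p ^+ k) ^+ 2 by exact: exprAC.
rewrite -pE !exprC.
have xy : epsp p ^+ i.*2.+1 * epsp p ^+ (p - i.*2.+1) = 1.
  by rewrite -exprD subnKC // (prim_expr_order (epsp_prim p_pr)).
have xc := epsp_conj (odd_le_p i).
have yc := epsp_conj (leq_subr i.*2.+1 p); rewrite subKn // in yc.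
move: (epsp p ^+ i.*2.+1) (epsp p ^+ (p - i.*2.+1)) xy xc yc => x y xy xc yc.
rewrite normCK rmorphB /= xc yc.
transitivity (x * y + x * y - x ^+ 2 - y ^+ 2); first by ring.
transitivity (1 + (x * y) ^+ 2 - x ^+ 2 - y ^+ 2); last by ring.
by rewrite xy expr1n.
Qed.

Lemma sub_conj_sign (x : algC) : x - x^* = (if 0 < 'Im x then 'i else - 'i) * `|x - x^*|.
Proof.
have -> : x - x^* = 'i * ('Im x *+ 2).
  have i2 : 'i * 'i = -1 :> algC by rewrite -expr2 sqrCi.
  by rewrite ImE -mulr_natr divfK ?pnatr_eq0 // mulrA i2 mulN1r opprB.
rewrite normrM normCi mul1r normrMn; case: ifP => [/ltW x0|].
  by rewrite ger0_norm.
rewrite real_ltNge ?real0 ?Creal_Im // => /negbFE x0.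
by rewrite ler0_norm // mulNrn mulrNN.
Qed.

(** As a power of [p.-root (-1)] the exponent is even and below 2p; beyond p, splitting off the p-th
    power -1 flips the sign. *)
Let Im_epsp_gt0 (i : 'I_m) :
  (0 < 'Im (epsp p ^+ i.*2.+1)) = ((i.*2.+1).*2 < p)%N.
Proof.
rewrite /epsp -exprM mul2n; set k := (i.*2.+1).*2.
case: (ltnP k p) => [kp|pk]; first by apply: Im_rootN1_exp_gt0.
have kb : (0 < k - p < p)%N by have := ltn_ord i; have := pE; rewrite /k in pk *; lia.
rewrite -(subnKC pk) exprD rootN1_exp // mulN1r raddfN /= oppr_gt0.
by apply: le_gtF; apply/ltW/Im_rootN1_exp_gt0.
Qed.

(** The first [uphalf m] factors are i, the other [m./2] are -i; pairs cancel to 1, leaving one i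
    exactly when [m] is odd. *)
Lemma prod_sign_i :
  \prod_(i < m) (if ((i.*2.+1).*2 < p)%N then 'i else - 'i) =
  (if (p %% 4 == 1)%N then 1 else 'i) :> algC.
Proof.
have -> : (p %% 4 == 1)%N = ~~ odd m by have := pE; lia.
rewrite (eq_bigr (fun i : 'I_m => if (i < uphalf m)%N then 'i else - 'i)) => [|i _]; last first.
  by congr (if _ then _ else _); have := pE; lia.
rewrite -(big_mkord xpredT (fun i => if (i < uphalf m)%N then 'i else - 'i)).
have mE : (uphalf m + m./2 = m)%N by lia.
rewrite -{1}mE big_mkord big_split_ord /=.
under eq_bigr do rewrite ltn_ord.
under [X in _ * X]eq_bigr do rewrite ltnNge leq_addr /=.
rewrite !prodr_const !card_ord uphalf_half exprD -mulrA -exprMn mulrN -expr2 sqrCi opprK.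
by rewrite expr1n mulr1; case: (odd m).
Qed.

Lemma odd_sine_prodE :
  odd_sine_prod = (if (p %% 4 == 1)%N then 1 else 'i) * sqrtC p%:R.
Proof.
rewrite -odd_sine_prod_norm /odd_sine_prod normr_prod -prod_sign_i -big_split /=.
apply: eq_bigr => i _; rewrite -Im_epsp_gt0 -epsp_conj //; exact: sub_conj_sign.
Qed.

Lemma gaussE : gauss p = (if (p %% 4 == 1)%N then 1 else 'i) * sqrtC p%:R.
Proof.
have : gauss p ^+ 2 == odd_sine_prod ^+ 2.
  rewrite gauss_sqr odd_sine_prodE exprMn sqrtCK; apply/eqP; congr (_ * _).
  have -> : (p %% 4 == 1)%N = ~~ odd m by have := pE; lia.
  by rewrite -signr_odd; case: (odd m); rewrite ?sqrCi ?expr1n.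
rewrite eqf_sqr -odd_sine_prodE => /orP[/eqP //|/eqP GN].
(* The opposite sign would make -1 equal to 1 in ['F_p]. *)
have := @gauss_congr (-1); rewrite mulN1r => /(_ GN) /eqP.
by rewrite eq_sym -addr_eq0 -mulr2n (negPf (two_neq0_Fp p_pr p_odd)).
Qed.

End GaussSum.

(** * Trace and quadratic exponential sums *)

Section Trace.

Variables (p n : nat) (F : finFieldType).
Hypotheses (p_pr : prime p) (charF : p \in [pchar F]).

Lemma emb_nat k : emb F (k%:R : 'F_p) = k%:R.
Proof. by rewrite /emb val_Fp_nat // (GRing.natr_mod_pchar charF). Qed.

Lemma embD (x y : 'F_p) : emb F (x + y) = emb F x + emb F y.
Proof. by rewrite -[x]natr_Zp -[y]natr_Zp -natrD !emb_nat natrD. Qed.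

Lemma embM (x y : 'F_p) : emb F (x * y) = emb F x * emb F y.
Proof. by rewrite -[x]natr_Zp -[y]natr_Zp -natrM !emb_nat natrM. Qed.

Lemma emb0 : emb F (0 : 'F_p) = 0.
Proof. exact: mulr0n. Qed.

Lemma emb_eq0 (x : 'F_p) : emb F x = 0 -> x = 0.
Proof.
move/eqP; rewrite /emb -(dvdn_pcharf charF) (dvdn_pcharf (pchar_Fp p_pr)).
by rewrite natr_Zp => /eqP.
Qed.

Lemma emb_inj : injective (@emb F p).
Proof.
move=> x y xy; apply/eqP; rewrite -subr_eq0; apply/eqP/emb_eq0.
by rewrite embD xy -embD subrr emb0.
Qed.

Lemma emb_expp (x : 'F_p) i : emb F x ^+ (p ^ i) = emb F x.
Proof.
elim: i => [|i IH]; first by rewrite expn0 expr1.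
rewrite expnSr exprM IH.
have embX k : emb F (x ^+ k) = emb F x ^+ k.
  by elim: k => [|k E]; rewrite ?exprS ?embM ?E // !expr0 (emb_nat 1).
by rewrite -embX; have := expf_card x; rewrite card_Fp // => ->.
Qed.

(* The fixed points of the Frobenius map are the at most [p] roots of [X^p - X],
   so they all lie in the prime field. *)
Lemma emb_surj_Frobenius (t : F) : t ^+ p = t -> exists k : 'F_p, emb F k = t.
Proof.
move=> tp; have [/mapP[k _ ->]|tn] := boolP (t \in map (@emb F p) (enum 'F_p)).
  by exists k.
have sz : size ('X^p - 'X : {poly F}) = p.+1.
  by rewrite size_polyDl ?size_polyXn // size_polyN size_polyX ltnS prime_gt1.
have nz : 'X^p - 'X != 0 :> {poly F} by rewrite -size_poly_eq0 sz.
have : (size (t :: map (@emb F p) (enum 'F_p)) < size ('X^p - 'X : {poly F})%R)%N.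
  apply: max_poly_roots => //=.
    apply/andP; split; first by rewrite rootE !hornerE tp subrr.
    apply/allP => _ /mapP[k _ ->]; rewrite rootE !hornerE.
    by have := emb_expp k 1; rewrite expn1 => ->; rewrite subrr.
  by rewrite tn map_inj_uniq ?enum_uniq //; exact: emb_inj.
by rewrite sz /= size_map -cardE card_Fp // ltnn.
Qed.

Hypothesis cardF : #|F| = (p ^ n)%N.

(** Frobenius permutes the terms of the trace cyclically, so the trace lies in the prime field and
    the default value in [Tr] is never reached. *)
Lemma emb_Tr (x : F) : emb F (Tr p n x) = trF p n x.
Proof.
rewrite /Tr; case: pickP => [k /eqP -> //|/= none].
have [k kE] : exists k : 'F_p, emb F k = trF p n x.
  apply: emb_surj_Frobenius; rewrite -(pFrobenius_autE charF) /trF rmorph_sum /=.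
  under eq_bigr do rewrite pFrobenius_autE -exprM -expnSr.
  case: n cardF => [_|k cF]; first by rewrite !big_ord0.
  rewrite big_ord_recr [RHS]big_ord_recl /= expn0 expr1 addrC; congr (_ + _).
  by rewrite -cF expf_card.
by have := none k; rewrite kE eqxx.
Qed.

Lemma TrD (x y : F) : Tr p n (x + y) = Tr p n x + Tr p n y.
Proof.
apply: emb_inj; rewrite embD !emb_Tr /trF -big_split /=; apply: eq_bigr => i _.
elim: {i}(i : nat) => [|i IH]; first by rewrite expn0 !expr1.
by rewrite expnSr !exprM IH -(pFrobenius_autE charF) rmorphD /= !pFrobenius_autE.
Qed.

Lemma Tr0 : Tr p n (0 : F) = 0.
Proof. by apply: (addrI (Tr p n (0 : F))); rewrite -TrD addr0 addr0. Qed.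

Lemma Tr_embM c (x : F) : Tr p n (emb F c * x) = c * Tr p n x.
Proof.
apply: emb_inj; rewrite embM !emb_Tr /trF mulr_sumr; apply: eq_bigr => i _.
by rewrite exprMn emb_expp.
Qed.

Lemma Tr_sum (I : finType) (f : I -> F) : Tr p n (\sum_i f i) = \sum_i Tr p n (f i).
Proof. by apply: (big_morph (@Tr F p n)); [exact: TrD | exact: Tr0]. Qed.

(** The linear part of the Walsh exponent in the coordinates y with x = Cy; vectors are rows, whence
    [y *m C^T]. *)
Lemma Tr_coordmap (alpha : 'I_n -> F) (C : 'M['F_p]_n) b (y : 'rV_n) :
  Tr p n (b * coordmap alpha (y *m C^T)) =
  \sum_i (\sum_j C j i * Tr p n (b * alpha j)) * y 0 i.
Proof.
rewrite /coordmap mulr_sumr Tr_sum.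
under eq_bigr => j _ do rewrite mulrCA Tr_embM mxE mulr_suml.
rewrite exchange_big /=; apply: eq_bigr => i _; rewrite mulr_suml.
by apply: eq_bigr => j _; rewrite mxE; ring.
Qed.

End Trace.

(** * One-variable quadratic sums and their products *)

Section QuadraticSums.

Variable p : nat.
Hypotheses (p_pr : prime p) (p_odd : odd p).

Definition qsum (d c : 'F_p) : algC := \sum_y epow (d * y ^+ 2 - c * y).

Lemma qsum_neq0 (d c : 'F_p) : d != 0 ->
  qsum d c = Defs.eta d * gauss p * epow (- (c ^+ 2 / (4%:R * d))).
Proof.
move=> d0; have t0 := two_neq0_Fp p_pr p_odd.
rewrite -gauss_twist // mulr_suml /qsum.
rewrite (reindex_inj (addIr (c / (2%:R * d)))); apply: eq_bigr => y _ /=.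
rewrite -epowD //; congr epow.
by field; rewrite d0 t0 (natrM _ 2 2) mulf_neq0.
Qed.

Lemma qsum0 (c : 'F_p) : qsum 0 c = if c == 0 then p%:R else 0.
Proof.
rewrite -(oppr_eq0 c) -sum_epow_lin //; apply: eq_bigr => y _.
by rewrite mul0r sub0r mulNr.
Qed.

Lemma prod_qsum n (d c : 'I_n -> 'F_p) :
  \sum_(y : 'rV['F_p]_n) epow (\sum_i (d i * y 0 i ^+ 2 - c i * y 0 i)) =
  \prod_i qsum (d i) (c i).
Proof.
rewrite bigA_distr_bigA /=.
rewrite (reindex (fun f : {ffun 'I_n -> 'F_p} => \row_i f i)) /=; last first.
  exists (fun y : 'rV_n => [ffun i => y 0 i]) => y _.
    by apply/ffunP => i; rewrite ffunE mxE.
  by apply/rowP => i; rewrite mxE ffunE.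
apply: eq_bigr => f _; rewrite epow_sum //; apply: eq_bigr => i _.
by rewrite !mxE.
Qed.

Lemma norm_qsum0 (d : 'F_p) : `|qsum d 0| ^+ 2 = p%:R ^+ (if d == 0 then 2 else 1).
Proof.
case: eqP => [->|/eqP d0]; first by rewrite qsum0 eqxx normr_nat.
rewrite qsum_neq0 // !normrM epow_norm // mulr1 exprMn !normCK norm_gauss //.
by rewrite -normCK -normrX eta_sqr_neq0 // normr1 mul1r expr1.
Qed.

(** When [p %% 4] is not 1, the parity cases of [kappa] spell out i^(n-1), the contribution of n - 1
    Gauss sums. *)
Lemma kappaE n (Delta : 'F_p) : (2 <= n)%N ->
  kappa n Delta = Defs.eta Delta * (if (p %% 4 == 1)%N then 1 else 'i) ^+ n.-1.
Proof.
move=> n2; rewrite /kappa; case: ifP => _; first by rewrite expr1n mulr1.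
have i2 k : 'i ^+ (k * 2) = (-1) ^+ k :> algC by rewrite mulnC exprM sqrCi.
case: ifP => on.
  have -> : (n.-1 = ((n - 2) %/ 2) * 2 + 1)%N by lia.
  by rewrite exprD i2 expr1 mulrA [_ * Defs.eta _]mulrC.
have -> : (n.-1 = ((n - 1) %/ 2) * 2)%N by lia.
by rewrite i2 mulrC.
Qed.

End QuadraticSums.

(** * Rank of the form and values of its Walsh transform *)

Theorem theorem6 (p n : nat) (F : finFieldType)
  (p_prime : prime p) (p_odd : odd p) (n_ge2 : (2 <= n)%N)
  (charF : p \in [pchar F]) (cardF : #|F| = (p ^ n)%N)
  (l : nat) (a : 'I_l.+1 -> F)
  (nb : near_bent n (quadf p n a))
  (alpha : 'I_n -> F) (alpha_basis : bijective (@coordmap F p n alpha))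
  (A : 'M['F_p]_n) (A_sym : A^T = A)
  (A_repr : forall x : 'rV['F_p]_n,
      quadf p n a (@coordmap F p n alpha x) = (x *m A *m x^T) 0 0)
  (C D : 'M['F_p]_n) (C_unit : C \in unitmx) (D_diag : is_diag_mx D)
  (CAC : C^T *m A *m C = D) :
  #|[set i : 'I_n | D i i != 0]| = n.-1 /\
  (let Delta := \prod_(i < n | D i i != 0) D i i in
   exists J : F -> 'F_p, forall b : F,
     walsh n (quadf p n a) b = 0 \/
     walsh n (quadf p n a) b =
       kappa n Delta * sqrtC (p%:R) ^+ n.+1 * epow (J b)).
Proof.
pose c b i := \sum_j C j i * Tr p n (b * alpha j).
have walshE b : walsh n (quadf p n a) b = \prod_i qsum (D i i) (c b i).
  rewrite -prod_qsum // /walsh.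
  have CT : C^T \in unitmx by rewrite unitmx_tr.
  pose M (y : 'rV['F_p]_n) := y *m C^T.
  have Mbij : bijective M by exists (mulmx^~ (invmx C^T)) => y; rewrite /M ?mulmxK ?mulmxKV.
  rewrite (reindex (coordmap alpha \o M)); last exact/onW_bij/bij_comp.
  apply: eq_bigr => y _ /=; rewrite A_repr Tr_coordmap // sumrB; congr (epow (_ - _)).
  rewrite /M trmx_mul trmxK.
  have -> : y *m C^T *m A *m (C *m y^T) = y *m D *m y^T by rewrite -CAC !mulmxA.
  have [e ->] := diag_mxP _ D_diag.
  rewrite mul_mx_diag !mxE; apply: eq_bigr => i _.
  by rewrite !mxE eqxx mulr1n; ring.
set r := #|[set i : 'I_n | D i i != 0]|.
have r_le : (r <= n)%N by rewrite -[X in (_ <= X)%N]card_ord max_card.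
have nzE : #|(fun i : 'I_n => D i i != 0)| = r by rewrite -cardsE.
have zerosE : #|(fun i : 'I_n => D i i == 0)| = (n - r)%N.
  rewrite -cardsE.
  have := cardsC [set i : 'I_n | D i i != 0]; rewrite card_ord -/r => nE.
  transitivity #|~: [set i : 'I_n | D i i != 0]|; last first.
    by move/(congr1 (subn^~ r)): nE; rewrite addKn.
  by apply: eq_card => i; rewrite !inE negbK.
have rE : r = n.-1.
  have c0 i : c 0 i = 0.
    by apply: big1 => j _; rewrite mul0r Tr0 // mulr0.
  (* At 0 each nonzero entry contributes p and each zero entry p^2; near-bentness then reads 2n - r
     = n + 1. *)
  have : `|walsh n (quadf p n a) 0| ^+ 2 = (p ^ (r + 2 * (n - r)))%:R.
    rewrite walshE normr_prod -prodrXl.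
    under eq_bigr => i _ do rewrite c0 norm_qsum0 //.
    rewrite natrX prodrXr; congr (_ ^+ _).
    rewrite (bigID (fun i => D i i == 0)) /= addnC.
    rewrite (eq_bigr (fun=> 1%N)) => [|i /negPf -> //].
    rewrite [X in (_ + X)%N](eq_bigr (fun=> 2%N)) => [|i -> //].
    by rewrite !sum_nat_const nzE zerosE muln1 mulnC.
  have p0 k : (p ^ k)%:R != 0 :> algC by rewrite pnatr_eq0 -lt0n expn_gt0 prime_gt0.
  case: (nb 0) => -> /eqP; first by rewrite eq_sym (negPf (p0 _)).
  rewrite eqr_nat eqn_exp2l ?prime_gt1 // => /eqP; lia.
(* [J] collects the terms -c^2 / (4d) left by completing the squares. *)
split => //= ; exists (fun b => \sum_(i | D i i != 0) - (c b i ^+ 2 / (4%:R * D i i))) => b.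
(* A zero entry with nonzero linear coefficient makes the whole product vanish. *)
have [/existsP[i /andP[/eqP Di ci]]|ok] := boolP [exists i, (D i i == 0) && (c b i != 0)].
  by left; rewrite walshE (bigD1 i) //= Di qsum0 // (negPf ci) mul0r.
right; rewrite walshE (bigID (fun i => D i i == 0)) /=.
rewrite (eq_bigr (fun=> p%:R)) => [|i /eqP Di]; last first.
  rewrite Di qsum0 // ifT //; apply: contraNT ok => ci; apply/existsP.
  by exists i; rewrite Di eqxx.
under [X in _ * X]eq_bigr => i Di do rewrite qsum_neq0 //.
rewrite !big_split /= epow_sum // -eta_prod //.
rewrite !prodr_const nzE zerosE rE kappaE //.
(* The single zero entry gives p, that is two factors sqrt p, which join the n - 1 from the Gauss
   sums. *)
have -> : (n - n.-1 = 1)%N by lia.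
rewrite expr1 gaussE // exprMn -{1}[p%:R]sqrtCK.
have -> : n.+1 = (2 + n.-1)%N by lia.
by rewrite exprD; ring.
Qed.
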